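(* Let $X$ be an $\omega$-well-filtered $T_0$ space. Then $X$ is locally compact if and only if $X$ is core compact.
   Context: A subset of a space is saturated if it is an intersection of open sets. A family of sets is filtered if it is nonempty and any two members contain a third member of the family. A $T_0$ space $X$ is $\omega$-well-filtered if for every countable filtered family $\{K_i : i<\omega\}$ of nonempty compact saturated subsets of $X$ and every open $U\subseteq X$, $\bigcap_{i<\omega}K_i\subseteq U$ implies $K_{i_0}\subseteq U$ for some $i_0<\omega$. A space $X$ is core compact if its lattice of open sets $\mathcal O(X)$ (ordered by inclusion) is a continuous lattice. A space is locally compact if every point has a neighborhood base of compact sets. *)

(* Defs.v *)
From HB Require Import structures.
From mathcomp Require Import all_boot all_order.
From mathcomp Require Import boolp classical_sets topology.

Set Implicit Arguments.
Unset Strict Implicit.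
Unset Printing Implicit Defensive.

Import Order.TTheory.
Local Open Scope classical_set_scope.

Section ContinuousLattice.
Context {d : Order.disp_t} (L : porderType d).

Definition directed (D : set L) : Prop :=
  D !=set0 /\
  forall x y, D x -> D y -> exists z, [/\ D z, (x <= z)%O & (y <= z)%O].

(* supremums D is the set of least upper bounds of D (at most a singleton). *)
Definition way_below (x y : L) : Prop :=
  forall (D : set L) (s : L), directed D -> supremums D s -> (y <= s)%O ->
    exists2 z, D z & (x <= z)%O.

(* Existence of all suprema, including that of set0, yields all infima. *)
Definition complete_lattice : Prop :=
  forall A : set L, supremums A !=set0.

Definition continuous_lattice : Prop :=
  complete_lattice /\
  forall y : L, directed [set x | way_below x y] /\
                supremums [set x | way_below x y] y.

End ContinuousLattice.

(* The lattice O(X): the order is inherited from the one on set X, which is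
   inclusion (subsetEset). *)
Record opens (X : topologicalType) : Type :=
  Opens { opens_set :> set X; _ : opens_set \in @open X }.

Section OpensOrder.
Variable X : topologicalType.
HB.instance Definition _ := [isSub for @opens_set X].
HB.instance Definition _ := [Choice of opens X by <:].
HB.instance Definition _ :=
  [SubChoice_isSubPOrder of opens X by <: with set_display].
End OpensOrder.

Lemma opens_leE (X : topologicalType) (U V : opens X) :
  (U <= V)%O = (U `<=` V) :> Prop.
Proof. by rewrite -subsetEset. Qed.

Section Spaces.
Variable X : topologicalType.

Definition core_compact : Prop := continuous_lattice (opens X).

(* The library's locally_compact only asks each point to have one neighborhood
   that is closed and compact, which differs from this for non-Hausdorff X. *)
Definition has_compact_nbhs_bases : Prop :=
  forall (x : X) (A : set X), nbhs x A ->
    exists K : set X, [/\ nbhs x K, compact K & K `<=` A].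

Definition saturated (A : set X) : Prop :=
  exists2 F : set (set X), F `<=` open & A = \bigcap_(U in F) U.

Definition filtered (F : set (set X)) : Prop :=
  F !=set0 /\
  forall A B, F A -> F B -> exists C, [/\ F C, C `<=` A & C `<=` B].

Definition omega_well_filtered : Prop :=
  forall K : nat -> set X,
    filtered (range K) ->
    (forall i, [/\ K i !=set0, compact (K i) & saturated (K i)]) ->
    forall U : set X, open U ->
      \bigcap_i K i `<=` U -> exists i0, K i0 `<=` U.

End Spaces.

(* Main.v *)
Require Import Defs.
From mathcomp Require Import all_boot all_order.
From mathcomp Require Import boolp classical_sets topology.

(** If every point has a base of compact neighborhoods, then an open set [V] is
    way below an open set [U] whenever a compact set lies between them, and the
    interiors of the compact subsets of [U] cover [U]; so O(X) is continuous
    ([core_compact_of_compact_nbhs]).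

    Conversely, suppose that O(X) is continuous and that [x] lies in the open
    set [B]. Pick [V] containing [x] and way below [B]. The way-below relation
    of a continuous lattice interpolates, which gives a sequence of open sets
    [V << ... << U 2 << U 1 << U 0 = B]. The intersection of the [U n] contains
    [V] and is contained in [B], so it remains to see that it is compact. The
    open sets containing some [U n] form a Scott-open filter, so compactness
    follows once each open set containing the intersection belongs to this
    filter, which is the Hofmann-Mislove property for it. In general
    that property characterizes sobriety, but here the filter has a countable
    base, and omega-well-filteredness is enough ([bigcap_way_below_chain]): an
    open set violating it can be taken maximal outside the filter, and then any
    sequence chosen in the [U n] outside that maximal set has compact tails,
    whose saturations form a countable filtered family. *)

Set Implicit Arguments.
Unset Strict Implicit.
Unset Printing Implicit Defensive.

Import Order.TTheory.
Local Open Scope classical_set_scope.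

(** * The way-below relation and maximal elements *)

Section WayBelow.
Context {d : Order.disp_t} (L : porderType d).
Implicit Types (x y z : L) (D : set L).

Lemma way_belowW x y : way_below x y -> (x <= y)%O.
Proof.
move=> xy.
have [z -> //] : exists2 z, [set y] z & (x <= z)%O.
apply: (xy [set y] y) => //.
  by split; [exists y | move=> _ _ -> ->; exists y].
by split=> [_ ->|z]; [exact: lexx | exact].
Qed.

Lemma le_way_below_trans x y z : (x <= y)%O -> way_below y z -> way_below x z.
Proof.
move=> xy yz D s dD sD zs; have [w Dw yw] := yz D s dD sD zs.
by exists w => //; exact: le_trans yw.
Qed.

(** The elements way below some element way below [z] form a directed set whose
    supremum is still [z], by continuity applied twice; so [x] lies under one
    of them. *)
Lemma way_below_interpolation x z : continuous_lattice L -> way_below x z ->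
  exists2 y, way_below x y & way_below y z.
Proof.
move=> [_ cL] xz.
pose D := [set v | exists2 w, way_below v w & way_below w z].
suff [v [w vw wz] xv] : exists2 v, D v & (x <= v)%O.
  by exists w => //; exact: le_way_below_trans vw.
have [[[w0 w0z] dirz] [_ lubz]] := cL z.
apply: (xz D z) => //.
- split.
    by have [[[v vw0] _] _] := cL w0; exists v, w0.
  move=> v1 v2 [w1 vw1 wz1] [w2 vw2 wz2].
  have [w [wz w1w w2w]] := dirz _ _ wz1 wz2.
  (* [w] is the supremum of the elements way below it, so [v1] and [v2],
     being way below [w], lie under two of these. *)
  have below v : way_below v w -> exists2 u, way_below u w & (v <= u)%O.
    by have [dirw supw] := cL w; move=> vw; exact: (vw _ _ dirw supw (lexx _)).
  have le_wb v w' : way_below v w' -> (w' <= w)%O -> way_below v w.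
    by move=> vw' w'w E s dE sE ws; apply: (vw' E s dE sE); exact: le_trans ws.
  have [u1 u1w vu1] := below _ (le_wb _ _ vw1 w1w).
  have [u2 u2w vu2] := below _ (le_wb _ _ vw2 w2w).
  have [[_ dirw] _] := cL w.
  have [u [uw u1u u2u]] := dirw _ _ u1w u2w.
  by exists u; split; [exists w | exact: le_trans u1u | exact: le_trans u2u].
- split=> [v [w vw wz]|s ubs].
    exact: le_trans (way_belowW vw) (way_belowW wz).
  apply: lubz => w wz; have [_ [_ lubw]] := cL w.
  by apply: lubw => v vw; apply: ubs; exists w.
Qed.

(** The chain of interpolants [x << ... << u 2 << u 1 << u 0 = y] generates a
    filter which is open for the Scott topology. *)
Lemma way_below_chain x y : continuous_lattice L -> way_below x y ->
  exists u : nat -> L, [/\ u 0 = y, forall n, way_below (u n.+1) (u n)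
    & forall n, way_below x (u n)].
Proof.
move=> cL xy.
have next (z : {z | way_below x z}) :
    {z' : {z | way_below x z} | way_below (sval z') (sval z)}.
  apply: cid; case: z => z xz /=.
  by have [w xw wz] := way_below_interpolation cL xz; exists (exist _ w xw).
have [f [f0 fS]] := dependent_choice next (exist _ y xy).
by exists (sval \o f); split=> [|//|n]; [rewrite /= f0 | exact: (svalP (f n))].
Qed.

(** Zorn's lemma applies because the supremum of a chain avoiding a family that
    is inaccessible by directed suprema avoids that family too. *)
Lemma exists_maximal_avoiding (F : set L) (w : L) : complete_lattice L ->
  (forall D s, directed D -> supremums D s -> F s -> exists2 z, D z & F z) ->
  ~ F w ->
  exists m, [/\ (w <= m)%O, ~ F m & forall y, (m <= y)%O -> ~ F y -> y = m].
Proof.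
move=> cplL inacc Fw.
pose T := {x | (w <= x)%O /\ ~ F x}.
pose w' : T := exist _ w (conj (lexx w) Fw).
have [|||A totA|[m [wm Fm]] maxm] :=
    @Zorn T (fun a b => (sval a <= sval b)%O).
- by move=> ?; exact: lexx.
- by move=> a b c; exact: le_trans.
- move=> [a Pa] [b Pb] /= ab ba.
  have E : a = b by apply/eqP; rewrite eq_le ab ba.
  by rewrite E in Pa *; congr exist; exact: Prop_irrelevance.
- have [->|/set0P A0] := eqVneq A set0; first by exists w'.
  have [s sups] := cplL (sval @` A).
  have [ubs _] := sups.
  have Fs : ~ F s.
    move=> Fs; have [|z [a _ <-]] := inacc _ _ _ sups Fs.
    + split; first by case: A0 => a Aa; exists (sval a), a.
      move=> _ _ [a Aa <-] [b Ab <-].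
      have [ab|ba] := totA _ _ Aa Ab.
        by exists (sval b); split=> //; exists b.
      by exists (sval a); split=> //; exists a.
    + by case: (svalP a).
  have ws : (w <= s)%O.
    case: A0 => a Aa; apply: (le_trans (proj1 (svalP a))).
    by apply: ubs; exists a.
  by exists (exist _ s (conj ws Fs)) => a Aa; apply: ubs; exists a.
exists m; split=> // y my Fy.
by have /(congr1 sval) := maxm (exist _ y (conj (le_trans wm my) Fy)) my.
Qed.

End WayBelow.

(** * Open sets and compactness *)

Section Opens.
Variable X : topologicalType.
Implicit Types (U V O : opens X) (D : set (opens X)) (K H : set X).

Definition open_opens (A : set X) (oA : open A) : opens X := Opens (mem_set oA).

Lemma opens_open U : open U.
Proof. by case: U => U /= /set_mem. Qed.

Definition opens_bigcup D : opens X :=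
  open_opens (bigcup_open (fun O (_ : D O) => opens_open O)).

Lemma supremums_opens D U :
  supremums D U <-> (U : set X) = \bigcup_(O in D) (O : set X).
Proof.
have UE V : ubound D V <-> \bigcup_(O in D) (O : set X) `<=` V.
  split=> [ubV|DV O DO].
    by apply: bigcup_sub => O /ubV; rewrite opens_leE.
  by rewrite opens_leE; apply: subset_trans DV; exact: bigcup_sup.
split=> [[/UE DU lubU]|UD].
  apply/seteqP; split=> //.
  have : (U <= opens_bigcup D)%O by apply: lubU; apply/UE.
  by rewrite opens_leE.
by split=> [|V /UE]; [apply/UE; rewrite UD | rewrite -UD opens_leE].
Qed.

Lemma complete_lattice_opens : complete_lattice (opens X).
Proof.
by move=> D; exists (opens_bigcup D); exact/supremums_opens.
Qed.

Lemma way_below_opens V U : way_below V U <->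
  forall D, directed D -> U `<=` \bigcup_(O in D) (O : set X) ->
    exists2 O, D O & V `<=` O.
Proof.
split=> [VU D dD UD|VU D s dD /supremums_opens sD].
  have supD : supremums D (opens_bigcup D) by exact/supremums_opens.
  have [|O DO] := VU D _ dD supD; first by rewrite opens_leE.
  by rewrite opens_leE; exists O.
rewrite opens_leE sD => /(VU _ dD) [O DO VO].
by exists O => //; rewrite opens_leE.
Qed.

(** If no member of a directed cover contains [K], the differences [K `\` O]
    generate a proper filter without cluster point in [K]; conversely, for a
    filter without cluster point in [K], the open sets whose complement is in
    the filter form a directed cover of [K]. *)
Lemma compact_directed_cover K : compact K <->
  forall D, directed D -> K `<=` \bigcup_(O in D) (O : set X) ->
    exists2 O, D O & K `<=` O.
Proof.
split=> [cK D [[O0 DO0] dirD] KD|cK F PF FK].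
  apply: contrapT => noO.
  pose F := [set A | exists2 O, D O & K `\` O `<=` A].
  have FF : ProperFilter F.
    split.
      by move=> [O DO KO]; apply: noO; exists O; rewrite // -setD_eq0 -subset0.
    split; first by exists O0.
      move=> A B [O1 D1 A1] [O2 D2 B2].
      have [O [DO]] := dirD _ _ D1 D2; rewrite !opens_leE => O1O O2O.
      exists O => // x [Kx Ox].
      by split; [apply: A1; split=> // /O1O | apply: B2; split=> // /O2O].
    by move=> A B AB [O DO KA]; exists O => //; exact: subset_trans AB.
  have [|p [Kp]] := cK F FF; first by exists O0 => // x [].
  have [O DO Op] := KD _ Kp.
  move=> /(_ (K `\` O) O) []; first by exists O.
    exact: open_nbhs_nbhs (conj (opens_open O) Op).
  by move=> x [[_ nOx] Ox].
apply: contrapT => noclus.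
pose D := [set O : opens X | F (~` (O : set X))].
have [||O FO KO] := cK D.
- split.
    by exists (open_opens open0); rewrite /D /= setC0; exact: filterT.
  move=> O1 O2 FO1 FO2.
  exists (open_opens (openU (opens_open O1) (opens_open O2))).
  split; rewrite ?opens_leE /D /= ?setCU; first exact: filterI.
    exact: subsetUl.
  exact: subsetUr.
- move=> p Kp.
  have [A [B [FA nB AB]]] : exists A B, [/\ F A, nbhs p B & A `&` B = set0].
    apply: contrapT => noAB; apply: noclus; exists p; split=> // A B FA nB.
    by apply/set0P/eqP => AB; apply: noAB; exists A, B.
  exists (open_opens (@open_interior _ B)) => //.
  apply: filterS FA => x Ax /interior_subset Bx.
  by have : (A `&` B) x by []; rewrite AB.
- apply: (@filter_not_empty _ F).
  by apply: filterS (filterI FK FO) => x [/KO].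
Qed.

Lemma way_below_compact V U K : compact K -> V `<=` K -> K `<=` U ->
  way_below V U.
Proof.
move=> /compact_directed_cover cK VK KU; apply/way_below_opens => D dD UD.
have [O DO KO] := cK D dD (subset_trans KU UD).
by exists O => //; exact: subset_trans KO.
Qed.

(** * From compact neighborhoods to core compactness *)

Lemma core_compact_of_compact_nbhs :
  has_compact_nbhs_bases X -> core_compact X.
Proof.
move=> lcX; split; first exact: complete_lattice_opens.
move=> U; split; last first.
  apply/supremums_opens/seteqP; split; last first.
    by apply: bigcup_sub => V /way_belowW; rewrite opens_leE.
  move=> x Ux.
  have [K [xK cK KU]] := lcX x U (open_nbhs_nbhs (conj (opens_open U) Ux)).
  exists (open_opens (@open_interior _ K)) => //.
  by apply: way_below_compact cK _ KU; exact: interior_subset.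
split.
  exists (open_opens open0); apply: (way_below_compact (K := set0)) => //.
  exact: compact0.
move=> V1 V2 /way_below_opens V1U /way_below_opens V2U.
exists (open_opens (openU (opens_open V1) (opens_open V2))).
split; rewrite ?opens_leE; [|exact: subsetUl|exact: subsetUr].
apply/way_below_opens => D dD UD.
have [O1 DO1 VO1] := V1U _ dD UD; have [O2 DO2 VO2] := V2U _ dD UD.
have [O [DO]] := dD.2 _ _ DO1 DO2; rewrite !opens_leE => O1O O2O.
exists O => // x [/VO1/O1O|/VO2/O2O] //.
Qed.

(** * Saturations and compact tails of sequences *)

Definition saturation H : set X :=
  \bigcap_(A in [set A | open A /\ H `<=` A]) A.

Lemma saturated_saturation H : saturated (saturation H).
Proof. by exists [set A | open A /\ H `<=` A] => // A []. Qed.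

Lemma sub_saturation H : H `<=` saturation H.
Proof. by move=> x Hx A [_]; exact. Qed.

Lemma saturation_sub_open H (A : set X) : open A -> H `<=` A ->
  saturation H `<=` A.
Proof. by move=> oA HA x; apply. Qed.

Lemma saturationS H H' : H `<=` H' -> saturation H `<=` saturation H'.
Proof. by move=> HH' x Hx A [oA H'A]; apply: Hx; split=> // y /HH'/H'A. Qed.

Lemma compact_saturation H : compact H -> compact (saturation H).
Proof.
move=> /compact_directed_cover cH; apply/compact_directed_cover => D dD HD.
have [O DO HO] := cH D dD (subset_trans (@sub_saturation H) HD).
by exists O => //; apply: saturation_sub_open => //; exact: opens_open.
Qed.

(** One member of a directed cover already contains all but finitely many
    points, and directedness absorbs the remaining ones. *)
Lemma compact_tail (x : nat -> X) :
  (forall (A : set X) i, open A -> A (x i) ->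
    exists m, forall j, (m <= j)%N -> A (x j)) ->
  forall n, compact (x @` [set i | (n <= i)%N]).
Proof.
move=> xev n; apply/compact_directed_cover => D [_ dirD] covD.
have xcov j : (n <= j)%N -> exists2 O, D O & (O : set X) (x j).
  by move=> nj; apply: covD; exists j.
have [O0 DO0 O0n] := xcov n (leqnn n).
have [m O0m] := xev _ _ (opens_open O0) O0n.
suff [O [DO O0O Om]] : exists O, [/\ D O, O0 `<=` O &
    forall j, (n <= j)%N -> (j < m)%N -> (O : set X) (x j)].
  exists O => // _ [j nj <-].
  have [mj|jm] := leqP m j; [exact/O0O/O0m | exact: Om].
elim: m {O0m} => [|m [O [DO O0O Om]]]; first by exists O0; split.
have [nm|mn] := leqP n m; last first.
  exists O; split=> // j nj jm.
  by have := leq_trans mn (leq_trans nj jm); rewrite ltnn.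
have [O1 DO1 O1m] := xcov m nm.
have [O' [DO']] := dirD _ _ DO DO1; rewrite !opens_leE => OO' O1O'.
exists O'; split=> // [y /O0O/OO' //|j nj].
rewrite ltnS leq_eqVlt => /predU1P [-> | /(Om _ nj)]; first exact: O1O'.
exact: OO'.
Qed.

(** * From core compactness to compact neighborhoods *)

(** This is the Hofmann-Mislove property for the countably generated Scott-open
    filter [F] of the open sets containing some [U n]. If [W] is not in [F],
    enlarge it to a maximal open set [M] outside [F] and choose [x n] in [U n]
    but not in [M]. An open set containing some [x i] is not contained in [M],
    so by maximality its union with [M] contains some [U m], hence it contains
    all [x j] with [j >= m]. The tails of [x] are thus compact and
    their saturations decrease to a set inside the intersection of the [U n],
    hence inside [W]; one of them lies in [W], although [x] avoids [W]. *)
Lemma bigcap_way_below_chain (U : nat -> opens X) (W : set X) :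
  omega_well_filtered X -> (forall n, way_below (U n.+1) (U n)) ->
  open W -> \bigcap_n (U n : set X) `<=` W -> exists n, U n `<=` W.
Proof.
move=> wfX wbU oW capW; apply: contrapT => nUW.
have Udecr i j : (i <= j)%N -> U j `<=` U i.
  elim: j => [|j IH]; first by rewrite leqn0 => /eqP ->.
  rewrite leq_eqVlt => /predU1P [-> //|/IH]; apply: subset_trans.
  by have /way_belowW := wbU j; rewrite opens_leE.
pose F := [set O : opens X | exists n, U n `<=` O].
have [||M [WM nFM maxM]] :=
    @exists_maximal_avoiding _ _ F (open_opens oW) complete_lattice_opens.
- move=> D s dD /supremums_opens sD [n Uns].
  have /way_below_opens/(_ D dD) [|O DO UO] := wbU n; first by rewrite -sD.
  by exists O => //; exists n.+1.
- by move=> [n UW]; apply: nUW; exists n.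
have {}WM : W `<=` M by move: WM; rewrite opens_leE.
have /choice [x xP] : forall n, exists y, (U n : set X) y /\ ~ (M : set X) y.
  move=> n; apply: contrapT => noy; apply: nFM; exists n => y Uy.
  by apply: contrapT => nMy; apply: noy; exists y.
have xev (A : set X) i : open A -> A (x i) ->
    exists m, forall j, (m <= j)%N -> A (x j).
  move=> oA Axi; pose MA := open_opens (openU (opens_open M) oA).
  have [m Um] : F MA.
    apply: contrapT => nFMA.
    have /(congr1 (@opens_set X)) MAM : MA = M.
      by apply: maxM => //; rewrite opens_leE; exact: subsetUl.
    by apply: (xP i).2; rewrite -MAM; right.
  exists m => j mj.
  by have /Um [/(xP j).2|] := Udecr _ _ mj _ (xP j).1.
pose K n := saturation (x @` [set i | (n <= i)%N]).
have Kdecr i j : (i <= j)%N -> K j `<=` K i.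
  move=> ij; have tails : [set k | (j <= k)%N] `<=` [set k | (i <= k)%N].
    by move=> k /=; exact: leq_trans.
  exact: saturationS (image_subset x tails).
have xK n : K n (x n) by move=> A [_]; apply; exists n => /=.
have [|||n] := wfX K _ _ W oW.
- split; first by exists (K 0), 0.
  move=> _ _ [i _ <-] [j _ <-]; exists (K (maxn i j)).
  split; first by exists (maxn i j).
    exact: Kdecr (leq_maxl i j).
  exact: Kdecr (leq_maxr i j).
- move=> i; split; first by exists (x i).
    exact/compact_saturation/compact_tail.
  exact: saturated_saturation.
- move=> y Ky; apply: capW => n _.
  have KU : K n `<=` U n.
    apply: saturation_sub_open; first exact: opens_open.
    by move=> _ [j nj <-]; exact: Udecr nj _ (xP j).1.
  exact: KU (Ky n I).
- by move=> /(_ _ (xK n))/WM; exact: (xP n).2.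
Qed.

(** The union of a directed cover of the intersection contains some [U n], and
    [U n.+1 << U n] then puts [U n.+1] inside one member of the cover. *)
Lemma compact_bigcap_way_below_chain (U : nat -> opens X) :
  omega_well_filtered X -> (forall n, way_below (U n.+1) (U n)) ->
  compact (\bigcap_n (U n : set X)).
Proof.
move=> wfX wbU; apply/compact_directed_cover => D dD UD.
have [n UnD] :=
  bigcap_way_below_chain wfX wbU (opens_open (opens_bigcup D)) UD.
have /way_below_opens/(_ D dD UnD) [O DO UO] := wbU n.
by exists O => // y Uy; apply: UO; exact: Uy.
Qed.

Lemma compact_nbhs_of_core_compact :
  omega_well_filtered X -> core_compact X -> has_compact_nbhs_bases X.
Proof.
move=> wfX ccX x A; rewrite nbhsE => -[B [oB Bx] BA].
have [_ /supremums_opens BE] := ccX.2 (open_opens oB).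
have [V VB Vx] : (\bigcup_(V in [set V | way_below V (open_opens oB)])
    (V : set X)) x by rewrite -BE.
have [U [U0 wbU VU]] := way_below_chain ccX VB.
exists (\bigcap_n (U n : set X)); split.
- exists V => [|y Vy n _]; first by split=> //; exact: opens_open.
  by have /way_belowW := VU n; rewrite opens_leE; apply.
- exact: compact_bigcap_way_below_chain.
- by move=> y /(_ 0 I); rewrite U0 => /BA.
Qed.

End Opens.

Theorem theorem3p13 (X : topologicalType) :
  kolmogorov_space X -> omega_well_filtered X ->
  (has_compact_nbhs_bases X <-> core_compact X).
Proof.
move=> _ wfX; split; first exact: core_compact_of_compact_nbhs.
exact: compact_nbhs_of_core_compact.
Qed.
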